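(* Let $(R,\mathfrak{m})$ be an $F$-injective Cohen--Macaulay local ring of prime characteristic $p$ and dimension $d>0$, let $a_1,\dots,a_d$ be a system of parameters, $\mathfrak{q}:=(a_1,\dots,a_d)R$, and $H:=H^d_{\mathfrak{m}}(R)$. For $b\in R$ let $\mathfrak{q}(b):=\{c\in R: cb^{p^n}\in\mathfrak{q}^{[p^n]}\text{ for all } n\gg0\}$, and let $Z_{\mathfrak{q},R}:=\{\mathfrak{q}(b): b\in R\setminus\mathfrak{q}\}$. Then the set of maximal members (under inclusion) of $Z_{\mathfrak{q},R}$ equals the set of maximal members of $\mathcal{I}(H)\setminus\{R\}$.
   Context: $R[x,f]$ is the Frobenius skew polynomial ring (free left $R$-module on $x^i$, $i\ge0$, with $xr=r^px$). $H^d_{\mathfrak{m}}(R)$ has its natural left $R[x,f]$-module structure: via the Čech complex on $a_1,\dots,a_d$, $x[r/(a_1\cdots a_d)^j]=[r^p/(a_1\cdots a_d)^{jp}]$. The graded annihilator $\operatorname{grann}N$ of an $R[x,f]$-submodule $N$ is the set of $\sum r_ix^i$ with each $r_ix^i$ annihilating $N$. $\mathcal{I}(H)$ is the set of ideals $\mathfrak{b}$ of $R$ for which there is an $R[x,f]$-submodule $N$ of $H$ with $\operatorname{grann}N=\bigoplus_{n\ge0}\mathfrak{b}x^n$. $\mathfrak{q}^{[p^n]}$ is the ideal generated by $p^n$-th powers of elements of $\mathfrak{q}$. $F$-injective: the Frobenius-induced maps on all $H^i_\mathfrak{m}(R)$ are injective. *)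

(* Defs.v *)
From mathcomp Require Import all_boot all_algebra.
Set Implicit Arguments. Unset Strict Implicit. Unset Printing Implicit Defensive.
Import GRing.Theory.
Local Open Scope ring_scope.

Section CommAlg.
Variable R : comNzRingType.

Definition subset_of (I J : R -> Prop) : Prop := forall x, I x -> J x.
Definition sub_eq (I J : R -> Prop) : Prop := forall x, I x <-> J x.

Definition is_ideal (I : R -> Prop) : Prop :=
  [/\ I 0, (forall x y, I x -> I y -> I (x + y)) & (forall r x, I x -> I (r * x))].

Definition ideal_gen (S : R -> Prop) : R -> Prop :=
  fun x => exists s : seq (R * R),
    (forall u, u \in s -> S u.2) /\ x = \sum_(u <- s) u.1 * u.2.

Definition range_of (k : nat) (b : 'I_k -> R) : R -> Prop :=
  fun y => exists i, y = b i.

Definition noetherian : Prop :=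
  forall I, is_ideal I -> exists s : seq R, sub_eq I (ideal_gen (fun y => y \in s)).

Definition local_with_max (m : R -> Prop) : Prop :=
  is_ideal m /\ (forall x, m x <-> ~ (exists y, x * y = 1)).

Definition prime_ideal (P : R -> Prop) : Prop :=
  [/\ is_ideal P, ~ P 1 & forall x y, P (x * y) -> P x \/ P y].

Definition strict_sub (I J : R -> Prop) : Prop :=
  subset_of I J /\ exists x, J x /\ ~ I x.

Definition prime_chain (n : nat) : Prop :=
  exists P : nat -> R -> Prop,
    (forall i, (i <= n)%N -> prime_ideal (P i)) /\
    (forall i, (i < n)%N -> strict_sub (P i) (P i.+1)).

Definition krull_dim_eq (d : nat) : Prop := prime_chain d /\ ~ prime_chain d.+1.

Definition sop (m : R -> Prop) (d : nat) (a : 'I_d -> R) : Prop :=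
  [/\ krull_dim_eq d, (forall i, m (a i)) &
      forall x, m x -> exists e : nat, ideal_gen (range_of a) (x ^+ e)].

Definition regular_seq_in (m : R -> Prop) (k : nat) (x : 'I_k -> R) : Prop :=
  (forall i, m (x i)) /\
  ~ ideal_gen (range_of x) 1 /\
  forall i : 'I_k, forall y,
    ideal_gen (fun z => exists j : 'I_k, (j < i)%N /\ z = x j) (x i * y) ->
    ideal_gen (fun z => exists j : 'I_k, (j < i)%N /\ z = x j) y.

(* Cohen-Macaulay: depth R = dim R, i.e. m contains a regular sequence of
   length dim R (depth <= dim always holds). *)
Definition cohen_macaulay (m : R -> Prop) : Prop :=
  exists d, krull_dim_eq d /\ exists x : 'I_d -> R, regular_seq_in m x.

Section Cech.
Variables (k : nat) (b : 'I_k -> R).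

Definition prodS (S : {set 'I_k}) : R := \prod_(i in S) b i.
Definition sgnS (S : {set 'I_k}) (i : 'I_k) : R :=
  (-1) ^+ #|[set j in S | (j < i)%N]|.

(* A cochain is represented as (c, n) : its S-component is c S / b_S^n in
   R_{b_S}; only the components with #|S| equal to the degree matter. *)
Definition frac_eq (S : {set 'I_k}) (r : R) (n : nat) (r' : R) (n' : nat) : Prop :=
  exists N : nat, prodS S ^+ N * (r * prodS S ^+ n' - r' * prodS S ^+ n) = 0.

(* Cech differential (numerators, same exponent n): the image of
   c_{T\i}/b_{T\i}^n in R_{b_T} is c_{T\i} b_i^n / b_T^n *)
Definition cech_d (c : {set 'I_k} -> R) (n : nat) : {set 'I_k} -> R :=
  fun T => \sum_(i in T) sgnS T i * c (T :\ i) * b i ^+ n.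

Definition cocycle (deg : nat) (c : {set 'I_k} -> R) (n : nat) : Prop :=
  forall T : {set 'I_k}, #|T| = deg.+1 -> frac_eq T (cech_d c n T) n 0 0.

Definition coboundary (deg : nat) (c : {set 'I_k} -> R) (n : nat) : Prop :=
  exists (c' : {set 'I_k} -> R) (n' : nat),
    forall S : {set 'I_k}, #|S| = deg -> frac_eq S (cech_d c' n' S) n' (c S) n.

Definition frob_cochain (p : nat) (c : {set 'I_k} -> R) : {set 'I_k} -> R :=
  fun S => c S ^+ p.

Definition cech_frob_injective (p : nat) : Prop :=
  forall (deg : nat) (c : {set 'I_k} -> R) (n : nat),
    cocycle deg c n -> coboundary deg (frob_cochain p c) (n * p) ->
    coboundary deg c n.
End Cech.

(* F-injective: Frobenius is injective on all H^i_m(R), computed by the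
   Cech complex on any finite family whose ideal has radical m. *)
Definition F_injective (m : R -> Prop) (p : nat) : Prop :=
  forall (k : nat) (b : 'I_k -> R), (forall i, m (b i)) ->
    (forall x, m x -> exists e : nat, ideal_gen (range_of b) (x ^+ e)) ->
    cech_frob_injective b p.

Section TopLC.
Variables (d : nat) (a : 'I_d -> R) (p : nat).

(* (r, j) represents the class [r / (a_1 ... a_d)^j] in H *)
Definition Aprod : R := prodS a setT.
Definition top_cochain (r : R) : {set 'I_d} -> R :=
  fun S => if S == setT then r else 0.
Definition H_zero (u : R * nat) : Prop := coboundary a d (top_cochain u.1) u.2.
Definition H_add (u v : R * nat) : R * nat :=
  (u.1 * Aprod ^+ v.2 + v.1 * Aprod ^+ u.2, (u.2 + v.2)%N).
Definition H_scale (t : R) (u : R * nat) : R * nat := (t * u.1, u.2).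
Definition H_eq (u v : R * nat) : Prop := H_zero (H_add u (H_scale (-1) v)).
Definition H_frob (u : R * nat) : R * nat := (u.1 ^+ p, (u.2 * p)%N).

(* N (a predicate on representatives, closed under H_eq) is an
   R[x,f]-submodule of H *)
Definition Rxf_submodule (N : R * nat -> Prop) : Prop :=
  [/\ N (0, 0%N),
      (forall u v, N u -> N v -> N (H_add u v)),
      (forall t u, N u -> N (H_scale t u)),
      (forall u, N u -> N (H_frob u)) &
      (forall u v, N u -> H_eq u v -> N v)].

(* grann N = (+)_{n>=0} J x^n *)
Definition grann_is (N : R * nat -> Prop) (J : R -> Prop) : Prop :=
  forall (n : nat) (r : R),
    J r <-> (forall u, N u -> H_zero (H_scale r (iter n H_frob u))).

Definition in_IH (J : R -> Prop) : Prop :=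
  is_ideal J /\ exists N, Rxf_submodule N /\ grann_is N J.

Definition q_ideal : R -> Prop := ideal_gen (range_of a).
Definition q_frob (n : nat) : R -> Prop :=
  ideal_gen (fun y => exists z, q_ideal z /\ y = z ^+ (p ^ n)).
Definition q_of (bb : R) : R -> Prop :=
  fun c => exists n0 : nat, forall n : nat, (n0 <= n)%N -> q_frob n (c * bb ^+ (p ^ n)).

Definition in_Z (J : R -> Prop) : Prop :=
  exists bb, ~ q_ideal bb /\ sub_eq J (q_of bb).

Definition maximal_in (P : (R -> Prop) -> Prop) (J : R -> Prop) : Prop :=
  P J /\ forall J', P J' -> subset_of J J' -> subset_of J' J.

Definition in_IH_proper (J : R -> Prop) : Prop := in_IH J /\ ~ sub_eq J (fun _ => True).
End TopLC.
End CommAlg.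

(* Main.v *)
(** By depth sensitivity of the Koszul complex, d elements generating, up to
    radical, an ideal that contains a regular sequence of length d are regular
    modulo each other, so in a Cohen-Macaulay ring every power of a parameter
    is a nonzerodivisor modulo any powers of the other ones. Hence [r / A^j]
    vanishes in H (A the product of the parameters) iff r lies in
    (a_1^j, ..., a_d^j). F-injectivity then makes the condition defining
    q(b) hold for all n once it does for large n, and q(b) is the graded
    annihilator of the submodule of H killed by q(b) R[x,f], which contains
    [b / A]. Conversely a nonzero submodule N of H contains a nonzero socle-like
    class [b / A], so the ideal of grann N lies in q(b). Thus Z consists of
    proper members of I(H), and every proper member of I(H) lies in a member of
    Z, so both sets have the same maximal members. *)

Require Import Defs.
From Stdlib Require Import Classical.
From HB Require Import structures.
From mathcomp Require Import all_boot all_algebra.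
From mathcomp Require Import ring.
Set Implicit Arguments. Unset Strict Implicit. Unset Printing Implicit Defensive.
Import GRing.Theory.
Local Open Scope ring_scope.

(** * Ideals, generators and radicals *)

Section Ideals.
Variable R : comNzRingType.
Implicit Types (I J S : R -> Prop) (x y r : R).

Lemma ideal0 I : is_ideal I -> I 0.
Proof. by case. Qed.

Lemma idealD I x y : is_ideal I -> I x -> I y -> I (x + y).
Proof. by case=> _ + _; apply. Qed.

Lemma idealMl I r x : is_ideal I -> I x -> I (r * x).
Proof. by case=> _ _; apply. Qed.

Lemma idealMr I r x : is_ideal I -> I x -> I (x * r).
Proof. by rewrite mulrC; apply: idealMl. Qed.

Lemma idealN I x : is_ideal I -> I x -> I (- x).
Proof. by move=> hI /(idealMl (-1) hI); rewrite mulN1r. Qed.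

Lemma idealB I x y : is_ideal I -> I x -> I y -> I (x - y).
Proof. by move=> hI Ix /(idealN hI); apply: idealD. Qed.

Lemma idealBl I x y : is_ideal I -> I (x - y) -> I y -> I x.
Proof. by move=> hI h /(idealD hI h); rewrite subrK. Qed.

Lemma ideal_sum I (T : Type) (s : seq T) (P : pred T) (F : T -> R) :
  is_ideal I -> (forall i, P i -> I (F i)) -> I (\sum_(i <- s | P i) F i).
Proof.
move=> hI h; apply: big_ind => //; first exact: ideal0.
by move=> x y; apply: idealD.
Qed.

Lemma ideal_exp_leq I x k n : is_ideal I -> (k <= n)%N -> I (x ^+ k) -> I (x ^+ n).
Proof. by move=> hI /subnK <-; rewrite exprD; apply: idealMl. Qed.

Lemma ideal_gen_ideal S : is_ideal (ideal_gen S).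
Proof.
split.
- by exists [::]; rewrite big_nil.
- move=> _ _ [s [hs ->]] [t [ht ->]]; exists (s ++ t); rewrite big_cat.
  by split=> // u; rewrite mem_cat => /orP[/hs|/ht].
- move=> r _ [s [hs ->]]; exists [seq (r * u.1, u.2) | u <- s]; split.
    by move=> _ /mapP[u us ->] /=; apply: hs.
  by rewrite big_map mulr_sumr; apply: eq_bigr => u _; rewrite mulrA.
Qed.
Hint Resolve ideal_gen_ideal : core.

Lemma mem_ideal_gen S x : S x -> ideal_gen S x.
Proof.
move=> Sx; exists [:: (1, x)]; split; last by rewrite big_seq1 mul1r.
by move=> u; rewrite inE => /eqP ->.
Qed.

Lemma ideal_gen_min S I :
  is_ideal I -> subset_of S I -> subset_of (ideal_gen S) I.
Proof.
move=> hI SI _ [s [hs ->]]; rewrite big_seq; apply: ideal_sum => // u /hs.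
by move=> /SI; apply: idealMl.
Qed.

Lemma ideal_genS S S' :
  subset_of S S' -> subset_of (ideal_gen S) (ideal_gen S').
Proof.
by move=> h; apply: ideal_gen_min => // x /h; apply: mem_ideal_gen.
Qed.

(** [S'] only has to lie in [S] together with [b], so this serves lists as well as indexed
    families. *)
Lemma ideal_gen_adjoin S S' b x :
  (forall y, S' y -> y = b \/ S y) -> ideal_gen S' x ->
  exists r, ideal_gen S (x - r * b).
Proof.
move=> h; apply: (ideal_gen_min (I := fun x => exists r, ideal_gen S (x - r * b))).
  split.
  - by exists 0; rewrite mul0r subr0; apply: ideal0.
  - move=> y z [r hr] [t ht]; exists (r + t).
    have -> : y + z - (r + t) * b = (y - r * b) + (z - t * b) by ring.
    exact: idealD.
  - move=> t y [r hr]; exists (t * r).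
    have -> : t * y - t * r * b = t * (y - r * b) by ring.
    exact: idealMl.
move=> y /h [->|Sy]; first by exists 1; rewrite mul1r subrr; apply: ideal0.
by exists 0; rewrite mul0r subr0; apply: mem_ideal_gen.
Qed.

Lemma zero_ideal : @is_ideal R (fun x => x = 0).
Proof. by split=> // [x y -> ->|r x ->]; rewrite ?addr0 ?mulr0. Qed.

Lemma ideal_gen_empty S x : (forall y, ~ S y) -> ideal_gen S x -> x = 0.
Proof. by move=> S0; move: x; apply: ideal_gen_min => [|x /S0 //]; apply: zero_ideal. Qed.

Definition radical I x := exists e, I (x ^+ e).

Lemma radical_ideal I : is_ideal I -> is_ideal (radical I).
Proof.
move=> hI; split.
- by exists 1%N; rewrite expr1; apply: ideal0.
- move=> x y [e he] [f hf]; exists (e + f)%N; rewrite exprDn.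
  apply: ideal_sum => // i _; rewrite -mulr_natr; apply: idealMr => //.
  have [lefi|ltif] := leqP f i.
    by apply: idealMl => //; apply: ideal_exp_leq hf.
  apply: idealMr => //; apply: ideal_exp_leq he => //.
  by rewrite -addnBA ?leq_addr // ltnW.
- by move=> r x [e he]; exists e; rewrite exprMn; apply: idealMl.
Qed.

Lemma radical_exp I x e : radical I (x ^+ e) -> radical I x.
Proof. by move=> [f]; rewrite -exprM; exists (e * f)%N. Qed.

End Ideals.
#[local] Hint Resolve ideal_gen_ideal : core.

(** * The Koszul complex and its exactness modulo an ideal *)

Section Koszul.
Variable R : comNzRingType.
Implicit Types (s : seq R) (J : R -> Prop) (x y : R).

(** All degrees together: the two factors are the parts without and with the basis vector of the
    head element. *)
Fixpoint koszul s : lmodType R :=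
  if s is _ :: s' then (koszul s' * koszul s')%type else R^o.

(* The Koszul complex on [b :: s] is the mapping cone of multiplication by
   [b] on the complex on [s]. *)
Fixpoint kdiff s : koszul s -> koszul s :=
  match s with
  | [::] => fun _ => 0
  | b :: s' => fun u => (kdiff u.1, b *: u.1 - kdiff u.2)
  end.

(* [khom i] is homogeneity of degree [i - 1], so that [khom 0] is degree [-1]. *)
Fixpoint khom s (i : nat) : koszul s -> Prop :=
  match s with
  | [::] => fun u => i = 1%N \/ u = 0
  | b :: s' => fun u =>
      if i is i'.+1 then khom i u.1 /\ khom i' u.2 else u = 0
  end.

(* Componentwise membership in [J]: computing modulo it replaces working over
   the quotient ring. *)
Fixpoint kin J s : koszul s -> Prop :=
  match s with
  | [::] => fun u => J u
  | b :: s' => fun u => kin J u.1 /\ kin J u.2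
  end.

Fixpoint ktop s (r : R) : koszul s :=
  if s is _ :: s' then (0, ktop s' r) else r.


Lemma kdiff_is_linear s : linear (@kdiff s).
Proof.
elim: s => [|b s IH] r u v /=; first by rewrite scaler0 addr0.
apply: injective_projections => /=; first exact: IH.
by rewrite IH !scalerDr !scalerN !scalerA (mulrC b) opprD addrACA.
Qed.

HB.instance Definition _ s := GRing.isLinear.Build R (koszul s) (koszul s) *:%R
  (@kdiff s) (@kdiff_is_linear s).

Lemma kdiffZ s r (u : koszul s) : kdiff (r *: u) = r *: kdiff u.
Proof. exact: linearZ_LR. Qed.

Lemma kdiffB s (u v : koszul s) : kdiff (u - v) = kdiff u - kdiff v.
Proof. exact: raddfB. Qed.

Lemma kdiffD s (u v : koszul s) : kdiff (u + v) = kdiff u + kdiff v.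
Proof. exact: raddfD. Qed.

Lemma kdiffN s (u : koszul s) : kdiff (- u) = - kdiff u.
Proof. exact: raddfN. Qed.

Lemma kdiffK s (u : koszul s) : kdiff (kdiff u) = 0.
Proof.
elim: s u => [//|b s IH] u /=; apply: injective_projections => //=.
by rewrite kdiffB kdiffZ IH subr0 subrr.
Qed.

Lemma khom0 s i : khom i (0 : koszul s).
Proof. by elim: s i => [|b s IH] [|i] /=; auto. Qed.

Lemma khom_linear s i r (u v : koszul s) : khom i u -> khom i v -> khom i (r *: u + v).
Proof.
elim: s i u v => [|b s IH] [|i] /= u v.
- by move=> [//|->] [//|->]; right; rewrite scaler0 addr0.
- by move=> [-> _|->]; [left|move=> [|->]; [left|right; rewrite scaler0 addr0]].
- by move=> -> ->; rewrite scaler0 addr0.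
- by move=> [? ?] [? ?]; split; apply: IH.
Qed.

Lemma khomZ s i r (u : koszul s) : khom i u -> khom i (r *: u).
Proof. by move=> hu; rewrite -[_ *: _]addr0; apply: khom_linear => //; apply: khom0. Qed.

Lemma khomB s i (u v : koszul s) : khom i u -> khom i v -> khom i (u - v).
Proof. by move=> hu hv; rewrite addrC -scaleN1r; apply: khom_linear. Qed.

Lemma khom0E s (u : koszul s) : khom 0 u -> u = 0.
Proof. by case: s u => [|b s] u /= => [[]|]. Qed.

Lemma kdiff_hom s i (u : koszul s) : khom i u -> khom i.+1 (kdiff u).
Proof.
elim: s i u => [|b s IH] [|i] u //=; try by right.
  by move=> ->; split; [apply: IH; apply: khom0|rewrite scaler0 raddf0 subrr; apply: khom0].
move=> [h1 h2]; split; first exact: IH.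
by apply: khomB; [apply: khomZ|apply: IH].
Qed.

Lemma kin0 J s : is_ideal J -> kin J (0 : koszul s).
Proof. by move=> hJ; elim: s => [|b s IH] /=; [apply: ideal0|]. Qed.

Lemma kin_linear J s r (u v : koszul s) :
  is_ideal J -> kin J u -> kin J v -> kin J (r *: u + v).
Proof.
move=> hJ; elim: s u v => [|b s IH] u v /=.
  by move=> Ju Jv; apply: idealD => //; apply: idealMl.
by move=> [? ?] [? ?]; split; apply: IH.
Qed.

Lemma kinZ J s r (u : koszul s) : is_ideal J -> kin J u -> kin J (r *: u).
Proof. by move=> hJ hu; rewrite -[_ *: _]addr0; apply: kin_linear => //; apply: kin0. Qed.

Lemma kinD J s (u v : koszul s) : is_ideal J -> kin J u -> kin J v -> kin J (u + v).
Proof. by move=> hJ hu hv; rewrite -[u]scale1r; apply: kin_linear. Qed.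

Lemma kinB J s (u v : koszul s) : is_ideal J -> kin J u -> kin J v -> kin J (u - v).
Proof. by move=> hJ hu hv; rewrite addrC -scaleN1r; apply: kin_linear. Qed.

Lemma kinW J J' s (u : koszul s) : subset_of J J' -> kin J u -> kin J' u.
Proof.
move=> JJ'; elim: s u => [|b s IH] u /=; first exact: JJ'.
by move=> [/IH ? /IH].
Qed.

Lemma kin_eq0 J s (u : koszul s) : (forall x, J x -> x = 0) -> kin J u -> u = 0.
Proof.
move=> J0; elim: s u => [|b s IH] u /=; first exact: J0.
by move=> [/IH h1 /IH h2]; apply: injective_projections.
Qed.

Lemma kin_regular J x s (u : koszul s) :
  (forall y, J (x * y) -> J y) -> kin J (x *: u) -> kin J u.
Proof.
move=> hx; elim: s u => [|b s IH] u /=; first exact: hx.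
by move=> [/IH ? /IH].
Qed.

Lemma kin_scale_mem J x s (u : koszul s) : is_ideal J -> J x -> kin J (x *: u).
Proof. by move=> hJ Jx; elim: s u => [|b s IH] u /=; [apply: idealMr|]. Qed.

Lemma kin_diff J s (u : koszul s) : is_ideal J -> kin J u -> kin J (kdiff u).
Proof.
move=> hJ; elim: s u => [|b s IH] u /=; first by move=> _; apply: ideal0.
move=> [h1 h2]; split; first exact: IH.
by apply: kinB => //; [apply: kinZ|apply: IH].
Qed.

(** Multipliers of [x] are chosen component by component, and 0 where [u] vanishes by degree; this
    keeps [v] homogeneous. *)
Lemma kin_adjoin J J' x s i (u : koszul s) :
  is_ideal J -> (forall y, J' y -> exists r, J (y - r * x)) ->
  khom i u -> kin J' u -> exists v : koszul s, khom i v /\ kin J (u - x *: v).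
Proof.
move=> hJ hJ'; elim: s i u => [|b s IH] i u /=.
  case=> [->|->]; last by exists 0; rewrite scaler0 subrr; split; [right|apply: ideal0].
  by move=> /hJ' [r hr]; exists r; rewrite /GRing.scale /= mulrC; split; [left|].
case: i => [->|i [h1 h2] [k1 k2]].
  by exists 0; rewrite scaler0 subrr; split => //; apply: kin0 (b :: s) hJ.
have [v1 [? ?]] := IH _ _ h1 k1; have [v2 [? ?]] := IH _ _ h2 k2.
by exists (v1, v2).
Qed.

(** With [y - r * b] in the ideal of the tail, the homotopy is [r] times contraction against the
    head, plus the tail homotopy with the sign dictated by the cone. *)
Lemma koszul_homotopy s y : ideal_gen (fun z => z \in s) y ->
  exists h : koszul s -> koszul s,
    [/\ linear h, (forall u, kdiff (h u) + h (kdiff u) = y *: u),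
        (forall i u, khom i.+1 u -> khom i (h u)) &
        (forall J u, is_ideal J -> kin J u -> kin J (h u))].
Proof.
elim: s y => [|b s IH] y hy.
  have -> : y = 0 by apply: ideal_gen_empty hy.
  exists (fun=> 0); split => [r u v|u|i u _|J u hJ _].
  - by rewrite scaler0 addr0.
  - by rewrite scale0r addr0.
  - exact: khom0.
  - exact: kin0.
have [|r /IH [h [hl hh hd hJ]]] := @ideal_gen_adjoin _ (fun z => z \in s) _ b y _ hy.
  by move=> z; rewrite inE => /orP[/eqP|]; auto.
have hB u v : h (u - v) = h u - h v.
  by rewrite addrC -scaleN1r hl scaleN1r addrC.
have h0 : h 0 = 0 by have := hB 0 0; rewrite !subrr.
have hZ k u : h (k *: u) = k *: h u by rewrite -[k *: u]addr0 hl h0 addr0.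
exists (fun u => (r *: u.2 + h u.1, - h u.2)); split.
- move=> k u v; apply: injective_projections => /=.
    by rewrite !hl !scalerDr !scalerA (mulrC r) addrACA.
  by rewrite hl opprD scalerN.
- move=> u; apply: injective_projections => /=.
    by rewrite kdiffD kdiffZ addrACA scalerBr subrKC hh scalerBl scalerA subrKC.
  rewrite hB hZ opprB kdiffN opprK scalerDr scalerA [h _ - _]addrC addrACA addrK hh.
  by rewrite scalerBl (mulrC b) subrKC.
- move=> [|i] u /= [h1 h2].
    have -> : u.2 = 0 by apply: khom0E.
    by rewrite scaler0 add0r h0 oppr0 (khom0E (hd _ _ h1)).
  split; first by apply: khom_linear => //; apply: hd.
  by rewrite -scaleN1r; apply/khomZ/hd.
- move=> J u hJ' /= [h1 h2]; split; first by apply: kin_linear => //; apply: hJ.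
  by rewrite -scaleN1r; apply: kinZ => //; apply: hJ.
Qed.

(** Vanishing of the degree [i] Koszul cohomology of [R/J]; for [i = 0] the shift in [khom] forces
    [v = 0]. *)
Definition kexact s J i := forall u : koszul s, khom i.+1 u -> kin J (kdiff u) ->
  exists v : koszul s, khom i v /\ kin J (u - kdiff v).

(* The homotopy gives [x ^ e *: u = kdiff w] modulo [J]. Exactness modulo
   [J'] (that is, J + (x)) one degree below makes [w] a boundary plus a multiple
   of [x], so that one factor [x] can be cancelled; iterate. *)
Lemma kexact_step s J J' (x : R) e i :
  is_ideal J -> subset_of J J' -> (forall y, J' y -> exists r, J (y - r * x)) ->
  (forall y, J (x * y) -> J y) -> J' x -> is_ideal J' ->
  ideal_gen (fun z => z \in s) (x ^+ e) ->
  (if i is i'.+1 then kexact s J' i' else True) -> kexact s J i.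
Proof.
move=> hJ JJ' hJ' xreg J'x hI' xe ex u hu du.
have [h [hl hh hd hk]] := koszul_homotopy xe.
have : exists2 w : koszul s, khom i w & kin J (x ^+ e *: u - kdiff w).
  by exists (h u); [apply: hd|rewrite -hh addrC addKr; apply: hk].
elim: e {xe h hl hh hd hk} => [|e IH] [w hw kw].
  by exists w; rewrite scale1r in kw.
apply: IH.
(* Since [x] lies in [J'], so does [x ^+ e.+1 *: u]: thus [w] is a cocycle modulo [J']. *)
have kdw : kin J' (kdiff w).
  have -> : kdiff w = x * x ^+ e *: u - (x ^+ e.+1 *: u - kdiff w).
    by rewrite -exprS opprB subrKC.
  by apply: (kinB hI' _ (kinW JJ' kw)); rewrite -scalerA; apply: kin_scale_mem.
have [z hz [v kv]] : exists2 z : koszul s, khom i z &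
    exists v, kin J (w - kdiff v - x *: z).
  case: i ex hu hw => [|i] ex hu hw.
    exists 0; first exact: khom0.
    by exists 0; rewrite (khom0E hw) raddf0 scaler0 !subr0; apply: kin0.
  have [v [hv kv]] := ex _ hw kdw.
  have hwv : khom i.+1 (w - kdiff v) by apply: khomB => //; apply: kdiff_hom.
  by have [z [hz kz]] := kin_adjoin hJ hJ' hwv kv; exists z => //; exists v.
exists z => //; apply: (kin_regular xreg).
have := kinD hJ kw (kin_diff hJ kv).
by rewrite !kdiffB kdiffK subr0 kdiffZ addrA subrK exprS -scalerA -scalerBr.
Qed.

(** * The top degree of the Koszul complex *)

Lemma khom_top s (r : R) : khom (size s).+1 (ktop s r).
Proof. by elim: s => [|b s IH] /=; [left|split => //; apply: khom0]. Qed.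

Lemma khom_gt s i (u : koszul s) : khom ((size s).+2 + i) u -> u = 0.
Proof.
elim: s i u => [|b s IH] i u /=; first by case.
rewrite addSn => -[h1 h2]; apply: injective_projections; last exact: (IH i).
by apply: (IH i.+1); rewrite addnS.
Qed.

Lemma khom_topE s (u : koszul s) : khom (size s).+1 u -> exists r, u = ktop s r.
Proof.
elim: s u => [|b s IH] u /=; first by exists u.
move=> [h1 /IH [r hr]]; exists r; apply: injective_projections => //.
by apply: (@khom_gt _ 0); rewrite addn0.
Qed.

Lemma ktopB s (r t : R) : ktop s (r - t) = ktop s r - ktop s t.
Proof.
elim: s => //= b s IH; apply: injective_projections => //=; by rewrite subr0.
Qed.

Lemma ktopZ s (r t : R) : ktop s (r * t) = r *: ktop s t.
Proof.
elim: s => //= b s IH; apply: injective_projections => //=; by rewrite scaler0.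
Qed.

Lemma kdiff_top s (r : R) : kdiff (ktop s r) = 0.
Proof. by apply: (@khom_gt _ 0); rewrite addn0; apply/kdiff_hom/khom_top. Qed.

(** Top cohomology is the quotient by the generated ideal: a top boundary on [b :: s] is a multiple
    of [b] minus a top boundary on [s]. *)
Lemma ktop_boundary s (t : R) :
  ideal_gen (fun z => z \in s) t <->
  exists v : koszul s, khom (size s) v /\ kdiff v = ktop s t.
Proof.
elim: s t => [|b s IH] t /=.
  split=> [ht|[v [_ <-]]]; last exact: (ideal0 (ideal_gen_ideal _)).
  exists 0; split; first by right.
  by apply/esym; apply: ideal_gen_empty ht.
split.
  move=> /(ideal_gen_adjoin (S := fun z => z \in s) (b := b)) [].
    by move=> z; rewrite inE => /orP[/eqP|]; auto.
  move=> r /IH [v [hv dv]]; exists (ktop s r, - v); split.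
    by split; [apply: khom_top|rewrite -scaleN1r; apply: khomZ].
  apply: injective_projections => /=; first exact: kdiff_top.
  by rewrite kdiffN opprK dv ktopB mulrC ktopZ subrKC.
move=> [[u v] [/= [hu hv] [_ duv]]].
have [r ur] := khom_topE hu; rewrite {}ur in duv.
suff /(IH _).2 : exists v : koszul s, khom (size s) v /\ kdiff v = ktop s (b * r - t).
  move=> ht; have hS : subset_of (fun z => z \in s) (fun z => z \in b :: s).
    by move=> z; rewrite inE => ->; rewrite orbT.
  rewrite -[t](subKr (b * r)); apply: idealB => //; last exact: ideal_genS ht.
  by apply: idealMr => //; apply: mem_ideal_gen; rewrite inE eqxx.
by exists v; split=> //; rewrite ktopB ktopZ -duv subKr.
Qed.

(** If [kdiff v = ktop s (y * b)], then [(ktop s y, v)] is a cocycle; as it is a boundary, its first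
    component is one on the tail. *)
Lemma kexact_regular J b s y :
  is_ideal J -> (forall x, J x -> x = 0) -> kexact (b :: s) J (size s) ->
  ideal_gen (fun z => z \in s) (y * b) -> ideal_gen (fun z => z \in s) y.
Proof.
move=> hJ J0 ex /ktop_boundary [v [hv dv]].
have [|/=|[u' v'] /= [hw [h1 _]]] := ex (ktop s y, v).
- by split=> //; apply: khom_top.
- by rewrite kdiff_top dv mulrC ktopZ subrr; split; apply: kin0 hJ.
- have /subr0_eq e : ktop s y - kdiff u' = 0 by apply: kin_eq0 J0 h1.
  apply/ktop_boundary; exists u'; split; last exact/esym.
  (* With an empty tail the preimage has degree -1, hence is zero. *)
  by case: (size s) hw => [[-> _]|n []] //; apply: khom0.
Qed.

End Koszul.

(** * Depth sensitivity *)

Section Depth.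
Variables (R : comNzRingType) (d : nat) (x : 'I_d -> R).

Let prefix (l : nat) := ideal_gen (fun z => exists j : 'I_d, (j < l)%N /\ z = x j).
Let others (b : 'I_d -> R) (i : 'I_d) := ideal_gen (fun z => exists j, j != i /\ z = b j).

Hypothesis xreg : forall (i : 'I_d) y, prefix i (x i * y) -> prefix i y.

(** Killing one more [x l] costs one degree, so [i + l] is constant along the induction; for [l = 0]
    all degrees below [d] are exact. *)
Lemma koszul_exact_of_depth (s : seq R) :
  (forall i, radical (ideal_gen (fun z => z \in s)) (x i)) ->
  forall i l, (i + l < d)%N -> kexact s (prefix l) i.
Proof.
move=> xs.
suff step i l (ltl : (l < d)%N) :
    (if i is i'.+1 then kexact s (prefix l.+1) i' else True) -> kexact s (prefix l) i.
  elim=> [|i IH] l hil; apply: step => //.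
    exact: leq_ltn_trans (leq_addl _ _) hil.
  by apply: IH; rewrite addnS.
pose k := Ordinal ltl; have [e xe] := xs k.
apply: (@kexact_step _ s (prefix l) (prefix l.+1) (x k) e) => //.
- exact: ideal_gen_ideal.
- by apply: ideal_genS => z [j [jl ->]]; exists j; split=> //; apply: ltnW.
- move=> y; apply: ideal_gen_adjoin => z [j []].
  rewrite ltnS leq_eqVlt => /orP[/eqP jl ->|jl ->]; last by right; exists j.
  by left; congr x; apply: val_inj.
- exact: (xreg (i := k)).
- by apply: mem_ideal_gen; exists k.
- exact: ideal_gen_ideal.
Qed.

(* The relation given by [y * b i] is a cocycle of degree [d - 1]; exactness
   there makes it trivial. *)
Lemma regular_mod_others (b : 'I_d -> R) (i : 'I_d) y :
  (forall k, radical (ideal_gen (range_of b)) (x k)) ->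
  others b i (y * b i) -> others b i y.
Proof.
move=> xb.
pose s := [seq b j | j <- enum (predC1 i)].
have sP z : z \in s <-> exists j, j != i /\ z = b j.
  split=> [/mapP[j]|[j [ji ->]]].
    by rewrite mem_enum => ji ->; exists j.
  by apply: map_f; rewrite mem_enum.
have szs : (size s + 0 < d)%N.
  by rewrite addn0 size_map -cardE cardC1 card_ord prednK // (leq_ltn_trans _ (ltn_ord i)).
move=> hy; apply: ideal_genS (fun z => (sP z).1) _ _.
(* [prefix 0] is the zero ideal, so this is exactness over the ring itself, in degree [size s], that
   is [d - 1]. *)
apply: (@kexact_regular _ (prefix 0) (b i) s).
- exact: ideal_gen_ideal.
- by move=> z; apply: ideal_gen_empty => t [j []].
- apply: koszul_exact_of_depth szs => k.
  have [e he] := xb k; exists e; apply: ideal_genS he => z [j ->].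
  rewrite inE; case: (eqVneq j i) => [-> /=|ji]; first by rewrite eqxx.
  by apply/orP; right; apply/sP; exists j.
by apply: ideal_genS hy => z /sP.
Qed.

End Depth.

(** * Ideals generated by powers of parameters *)

Lemma ex_last_true (P : nat -> Prop) (n : nat) :
  P 0%N -> ~ P n -> exists e, P e /\ ~ P e.+1.
Proof.
elim: n => [//|n IH] P0 nP; case: (classic (P n)) => [Pn|]; last exact: IH.
by exists n.
Qed.

Section PowerIdeals.
Variables (R : comNzRingType) (d : nat) (a : 'I_d -> R).
Implicit Types (al : 'I_d -> nat) (i k : 'I_d) (y r : R).

(** Each variable has its own exponent, so that exponents can be changed one variable at a time. *)
Definition pow_ideal al : R -> Prop := ideal_gen (fun z => exists i, z = a i ^+ al i).

Definition pow_others al i : R -> Prop :=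
  ideal_gen (fun z => exists k, k != i /\ z = a k ^+ al k).

Lemma pow_ideal_ideal al : is_ideal (pow_ideal al).
Proof. exact: ideal_gen_ideal. Qed.

Lemma pow_others_sub al i : subset_of (pow_others al i) (pow_ideal al).
Proof. by apply: ideal_genS => z [k [_ ->]]; exists k. Qed.

Lemma pow_others_congr al be i :
  (forall k, k != i -> al k = be k) -> subset_of (pow_others al i) (pow_others be i).
Proof. by move=> h; apply: ideal_genS => z [k [ki ->]]; exists k; rewrite h. Qed.

Lemma pow_ideal_congr al be : al =1 be -> subset_of (pow_ideal al) (pow_ideal be).
Proof. by move=> h; apply: ideal_genS => z [k ->]; exists k; rewrite h. Qed.

Lemma pow_ideal_gen al i : pow_ideal al (a i ^+ al i).
Proof. by apply: mem_ideal_gen; exists i. Qed.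

Lemma pow_ideal_split al i y :
  pow_ideal al y -> exists r, pow_others al i (y - r * a i ^+ al i).
Proof.
apply: ideal_gen_adjoin => z [k ->].
by case: (eqVneq k i) => [->|ki]; [left|right; exists k].
Qed.

(** The form in which Cohen-Macaulayness enters all later arguments. *)
Definition powers_regular :=
  forall al i n y, pow_others al i (y * a i ^+ n) -> pow_others al i y.

Lemma regular_powers_regular (x : 'I_d -> R) :
  (forall (i : 'I_d) y,
     ideal_gen (fun z => exists j : 'I_d, (j < i)%N /\ z = x j) (x i * y) ->
     ideal_gen (fun z => exists j : 'I_d, (j < i)%N /\ z = x j) y) ->
  (forall i, radical (ideal_gen (range_of a)) (x i)) -> powers_regular.
Proof.
move=> xreg xa al i n y.
(* Exponent [n] at [i] makes the claim an instance for the family [a k ^+ be k], whose ideal still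
   has every [x k] in its radical. *)
pose be k := if k == i then n else al k.
have ab k : k != i -> al k = be k by rewrite /be => /negPf ->.
move=> /(pow_others_congr ab) h.
apply: (@pow_others_congr be) => [k /ab ->//|].
apply: (@regular_mod_others _ _ _ xreg (fun k => a k ^+ be k)).
  move=> k; have [e he] := xa k; apply: (@radical_exp _ _ _ e).
  apply: ideal_gen_min he; first exact/radical_ideal/ideal_gen_ideal.
  by move=> _ [j ->]; exists (be j); apply: mem_ideal_gen; exists j.
by rewrite {2}/be eqxx.
Qed.

Lemma colon_ideal (I : R -> Prop) c : is_ideal I -> is_ideal (fun y => I (y * c)).
Proof.
move=> hI; split.
- by rewrite mul0r; apply: ideal0.
- by move=> y z Iy Iz; rewrite mulrDl; apply: idealD.
- by move=> r y Iy; rewrite -mulrA; apply: idealMl.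
Qed.

Notation A := (Aprod a).
Notation "'I_[ j ]" := (pow_ideal (fun=> j)) (at level 0).

Lemma AprodX n : A ^+ n = \prod_(i <- enum 'I_d) a i ^+ n.
Proof.
rewrite /Aprod /prodS -prodrXl big_enum.
by apply: eq_bigl => i; rewrite inE.
Qed.


Lemma pow_ideal_mulA j n y : 'I_[j] y -> 'I_[(j + n)%N] (y * A ^+ n).
Proof.
move: y; apply: ideal_gen_min; first exact/colon_ideal/pow_ideal_ideal.
move=> _ [i ->]; rewrite /Aprod /prodS (bigD1 i) ?inE //= exprMn mulrA -exprD.
by apply: idealMr; [exact: pow_ideal_ideal|exact: (pow_ideal_gen (fun=> _) i)].
Qed.

Section Regular.
Hypothesis areg : powers_regular.

(** Modulo the other powers, [y * a i ^+ n] is a multiple of [a i ^+ (al i + n)], and regularity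
    cancels [a i ^+ n]. *)
Lemma pow_ideal_cancel al be i n y :
  be i = (al i + n)%N -> (forall k, k != i -> be k = al k) ->
  pow_ideal be (y * a i ^+ n) -> pow_ideal al y.
Proof.
move=> bi bk /(pow_ideal_split i) [r]; rewrite bi exprD mulrA -mulrBl.
move=> /areg /(pow_others_congr bk) /pow_others_sub h.
apply: (idealBl (pow_ideal_ideal _) h); apply: (idealMl _ (pow_ideal_ideal _)).
exact: pow_ideal_gen.
Qed.

(** Injectivity of the transition maps in the direct system with limit H; one variable of [l] is
    cancelled at a time. *)
Lemma pow_ideal_divA j n y : 'I_[(j + n)%N] (y * A ^+ n) -> 'I_[j] y.
Proof.
rewrite AprodX.
suff main l : uniq l ->
    pow_ideal (fun i => (j + (i \in l) * n)%N) (y * \prod_(i <- l) a i ^+ n) -> 'I_[j] y.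
  move=> h; apply: (main _ (enum_uniq 'I_d)).
  by apply: pow_ideal_congr h => i; rewrite mem_enum mul1n.
elim: l => [_|i l IH /= /andP[il ul]] h.
  rewrite big_nil mulr1 in h; apply: pow_ideal_congr h => i.
  by rewrite mul0n addn0.
apply: IH => //; rewrite big_cons mulrCA mulrC in h.
apply: (pow_ideal_cancel (i := i) (n := n) _ _ h).
  by rewrite inE eqxx (negPf il) mul1n mul0n addn0.
by move=> k ki; rewrite inE (negPf ki).
Qed.

(* In H: a nonzero class [r / A ^ j] has a nonzero multiple of the form
   [b / A]. The exponents are lowered from [j] to 1 one variable at a time. *)
Lemma nonzero_multiple j r : ~ 'I_[j] r ->
  exists t b, 'I_[j] (t * r - b * A ^+ j.-1) /\ ~ 'I_[1%N] b.
Proof.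
move=> nr; rewrite AprodX.
suff main l : uniq l -> exists t b,
    'I_[j] (t * r - b * \prod_(i <- l) a i ^+ j.-1) /\
    ~ pow_ideal (fun i => if i \in l then 1%N else j) b.
  have [t [b [h nb]]] := main _ (enum_uniq 'I_d); exists t, b; split=> // h1; apply: nb.
  by apply: pow_ideal_congr h1 => i; rewrite mem_enum.
elim: l => [_|i l IH /= /andP[il ul]].
  exists 1, r; rewrite big_nil mul1r mulr1 subrr; split=> //.
  exact: (ideal0 (pow_ideal_ideal _)).
have [t [b [h nb]]] := IH ul.
set al := fun i => if i \in l then 1%N else j in nb.
have ali : al i = j by rewrite /al (negPf il).
(* Pick [e] where multiplying [b * a i ^+ e] by [a i] first brings it into the ideal; at exponent
   [j] it is inside. *)
have [||e [ne]] := @ex_last_true (fun e => ~ pow_ideal al (b * a i ^+ e)) j.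
- by rewrite expr0 mulr1.
- by apply; apply: idealMl; [exact: pow_ideal_ideal|rewrite -ali; exact: pow_ideal_gen].
move=> /NNPP he.
have j0 : (0 < j)%N.
  rewrite lt0n; apply/eqP => j0; apply: ne; rewrite -[_ * _]mulr1.
  apply: idealMl; first exact: pow_ideal_ideal.
  by rewrite -[1](expr0 (a i)) -j0 -ali; exact: pow_ideal_gen.
have [s] := pow_ideal_split i he.
rewrite ali -[in X in _ - _ * a i ^+ X](prednK j0) !exprSr !mulrA -mulrBl -[X in _ * X]expr1.
move=> /areg hs.
(* After cancelling [a i], [b * a i ^+ e] equals [s * a i ^+ j.-1] modulo the other powers, so [s]
   is the new numerator. *)
exists (a i ^+ e * t), s; rewrite big_cons; set P := \prod_(_ <- _) _ in h *; split.
  have -> : a i ^+ e * t * r - s * (a i ^+ j.-1 * P)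
     = a i ^+ e * (t * r - b * P) + (b * a i ^+ e - s * a i ^+ j.-1) * P by ring.
  apply: (idealD (pow_ideal_ideal _)); first exact: (idealMl _ (pow_ideal_ideal _) h).
  move: (_ - _) hs; apply: ideal_gen_min; first exact/colon_ideal/pow_ideal_ideal.
  move=> _ [k [ki ->]]; rewrite /al; case: ifP => kl.
    rewrite /P (big_rem k) //= mulrA -exprD add1n prednK //.
    by apply: idealMr; [exact: pow_ideal_ideal|exact: (pow_ideal_gen (fun=> _) k)].
  by apply: idealMr; [exact: pow_ideal_ideal|exact: (pow_ideal_gen (fun=> _) k)].
move=> hs1; apply: ne; apply: (idealBl (pow_ideal_ideal _) (pow_others_sub hs)).
move: s hs1 {hs}; apply: ideal_gen_min; first exact/colon_ideal/pow_ideal_ideal.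
move=> _ [k ->]; rewrite inE; case: (eqVneq k i) => [->|ki] /=.
  by rewrite -exprD add1n prednK // -ali; apply: pow_ideal_gen.
by apply: idealMr; [exact: pow_ideal_ideal|exact: (pow_ideal_gen al k)].
Qed.

End Regular.
End PowerIdeals.

(** * Vanishing and Frobenius in top local cohomology *)

Section LocalCohomology.
Variables (R : comNzRingType) (d : nat) (a : 'I_d -> R) (p : nat).
Implicit Types (u v : R * nat) (b c r : R) (J : R -> Prop).

Notation A := (Aprod a).
Notation "'I_[ j ]" := (pow_ideal a (fun=> j)) (at level 0).

Lemma card_full (S : {set 'I_d}) : #|S| = d -> S = setT.
Proof.
by move=> Sd; apply/eqP; rewrite eqEcard subsetT cardsT card_ord Sd leqnn.
Qed.

Lemma pow_ideal_sum j r : 'I_[j] r -> exists c : 'I_d -> R, r = \sum_i c i * a i ^+ j.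
Proof.
move: r; apply: ideal_gen_min.
  split.
  - by exists (fun=> 0); rewrite big1 // => i _; rewrite mul0r.
  - move=> _ _ [c ->] [c' ->]; exists (fun i => c i + c' i); rewrite -big_split.
    by apply: eq_bigr => i _; rewrite mulrDl.
  - move=> r _ [c ->]; exists (fun i => r * c i); rewrite mulr_sumr.
    by apply: eq_bigr => i _; rewrite mulrA.
move=> _ [i ->]; exists (fun k => if k == i then 1 else 0).
rewrite (bigD1 i) //= eqxx mul1r big1 ?addr0 // => k /negPf ->.
by rewrite mul0r.
Qed.

(** A coboundary puts [r], multiplied by a power of [A], in the correspondingly raised power ideal;
    [pow_ideal_divA] cancels that power. *)
Lemma H_zeroE u : powers_regular a -> H_zero a u <-> 'I_[u.2] u.1.
Proof.
case: u => r j areg /=; split=> [[c' [n' /(_ setT)]]|/pow_ideal_sum [c ->]].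
  rewrite cardsT card_ord => /(_ erefl) [N] /=.
  rewrite /top_cochain eqxx -/A mulrBr => /subr0_eq e.
  apply: (pow_ideal_divA areg (n := (n' + N)%N)).
  have -> : r * A ^+ (n' + N) = cech_d a c' n' setT * A ^+ (j + N).
    transitivity (A ^+ N * (r * A ^+ n')); first by rewrite exprD; ring.
    by rewrite -e exprD; ring.
  have -> : (j + (n' + N) = n' + (j + N))%N by rewrite addnCA.
  apply: pow_ideal_mulA; apply: ideal_sum => [|i _]; first exact: pow_ideal_ideal.
  by apply: (idealMl _ (pow_ideal_ideal _ _)); exact: (pow_ideal_gen a (fun=> _) i).
(* For [S] of size [d - 1] the sum has one term, at the missing index; its sign cancels that of the
   differential. *)
exists (fun S : {set 'I_d} => \sum_(i | i \notin S) sgnS R setT i * c i), j => S /card_full ->.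
exists 0%N; rewrite /top_cochain eqxx mul1r -mulrBl -[RHS](mul0r (prodS a setT ^+ j)).
congr (_ * _); apply/eqP; rewrite subr_eq0; apply/eqP.
apply: eq_big => [i|i _]; first by rewrite inE.
rewrite (big_pred1 i) => [|k]; last by rewrite !inE andbT negbK.
by rewrite mulrA -expr2 sqrr_sign mul1r.
Qed.

Lemma iter_H_frob n u : iter n (H_frob p) u = (u.1 ^+ (p ^ n), u.2 * p ^ n)%N.
Proof.
elim: n => [|n IH]; first by rewrite expr1 muln1; case: u.
by rewrite iterS IH /H_frob /= -exprM -mulnA expnSr.
Qed.

(** F-injectivity is applied to the Cech complex on [a] in degree [d], where every cochain is a
    cocycle: no subset has [d + 1] elements. *)
Lemma F_injective_top (m : R -> Prop) j r :
  powers_regular a -> (0 < p)%N -> F_injective m p -> (forall i, m (a i)) ->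
  (forall x, m x -> exists e : nat, ideal_gen (range_of a) (x ^+ e)) ->
  'I_[(j * p)%N] (r ^+ p) -> 'I_[j] r.
Proof.
move=> areg p0 Fm ma mrad /(H_zeroE (r ^+ p, _) areg) [c' [n' h]].
apply/(H_zeroE (r, j) areg); apply: (Fm d a ma mrad) => [T Td|].
  by have := max_card (mem T); rewrite card_ord Td ltnn.
exists c', n' => S Sd; move: (h S Sd); rewrite (card_full Sd).
by rewrite /frob_cochain /top_cochain eqxx.
Qed.

(** * The ideals q(b) as graded annihilators *)

Section FInjective.
Hypotheses (areg : powers_regular a) (p_prime : prime p) (pR : p \in [pchar R]).
Hypothesis Finj : forall j r, 'I_[(j * p)%N] (r ^+ p) -> 'I_[j] r.

Lemma pfrobD n (x y : R) : (x + y) ^+ (p ^ n) = x ^+ (p ^ n) + y ^+ (p ^ n).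
Proof.
by rewrite exprDn_pchar // pnatX pnatE ?pR.
Qed.

Lemma pfrobN n (x : R) : (- x) ^+ (p ^ n) = - x ^+ (p ^ n).
Proof.
by apply/eqP; rewrite -subr_eq0 opprK -pfrobD addNr expr0n expn_eq0 eqn0Ngt prime_gt0.
Qed.

Lemma pow_ideal_frob j n r : 'I_[j] r -> 'I_[(j * p ^ n)%N] (r ^+ (p ^ n)).
Proof.
move: r; apply: ideal_gen_min; last first.
  by move=> _ [i ->]; rewrite -exprM; exact: (pow_ideal_gen a (fun=> _) i).
have hI := pow_ideal_ideal a (fun=> (j * p ^ n)%N); split.
- by rewrite expr0n expn_eq0 eqn0Ngt prime_gt0 //; apply: ideal0.
- by move=> x y ? ?; rewrite pfrobD; apply: idealD.
- by move=> r x ?; rewrite exprMn; apply: idealMl.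
Qed.

Lemma q_idealE r : q_ideal a r <-> 'I_[1%N] r.
Proof.
by split; apply: ideal_genS => z [i ->]; exists i; rewrite expr1.
Qed.

(** By additivity of Frobenius, the powers of the generators suffice. *)
Lemma q_frobE n r : q_frob a p n r <-> 'I_[(p ^ n)%N] r.
Proof.
split; last first.
  apply: ideal_genS => _ [i ->]; exists (a i); split=> //.
  by apply: mem_ideal_gen; exists i.
apply: ideal_gen_min; first exact: pow_ideal_ideal.
by move=> _ [z [/q_idealE /(pow_ideal_frob n) hz ->]]; rewrite mul1n in hz.
Qed.

Lemma q_ofE b c : q_of a p b c <-> forall n, 'I_[(p ^ n)%N] (c * b ^+ (p ^ n)).
Proof.
split=> [[n0 h] n|h]; last by exists 0%N => n _; apply/q_frobE.
have : 'I_[(p ^ (n0 + n))%N] (c * b ^+ (p ^ (n0 + n))).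
  by apply/q_frobE/h; rewrite leq_addr.
elim: n0 {h} => [//|k IH] h; apply: IH; apply: Finj.
(* Multiplying the condition one level up by [c ^+ p.-1] makes it a [p]-th power, to which [Finj]
   applies. *)
rewrite -expnSr exprMn -exprM -expnSr -(prednK (prime_gt0 p_prime)) exprSr.
rewrite (prednK (prime_gt0 p_prime)) -mulrA.
by apply: idealMl; first exact: pow_ideal_ideal.
Qed.

Lemma q_of_ideal b : is_ideal (q_of a p b).
Proof.
have hI n := pow_ideal_ideal a (fun=> (p ^ n)%N); split.
- by apply/q_ofE => n; rewrite mul0r; apply: ideal0.
- move=> x y /q_ofE hx /q_ofE hy; apply/q_ofE => n; rewrite mulrDl.
  exact: idealD.
- by move=> r x /q_ofE hx; apply/q_ofE => n; rewrite -mulrA; apply: idealMl.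
Qed.

Lemma H_zero_scale_iter c n u :
  H_zero a (H_scale c (iter n (H_frob p) u)) <->
  'I_[(u.2 * p ^ n)%N] (c * u.1 ^+ (p ^ n)).
Proof. by rewrite iter_H_frob; exact: (H_zeroE (H_scale c (_, _)) areg). Qed.

Lemma H_eqE u v :
  H_eq a u v <-> 'I_[(u.2 + v.2)%N] (u.1 * A ^+ v.2 - v.1 * A ^+ u.2).
Proof. by rewrite /H_eq -mulNr -[- v.1]mulN1r; exact: (H_zeroE (H_add a u (H_scale _ v)) areg). Qed.

(** The classes killed by every [c x^n] with [c] in [J], expressed on representatives through
    [H_zeroE]. *)
Definition annihilator (J : R -> Prop) u : Prop :=
  forall c, J c -> forall n, 'I_[(u.2 * p ^ n)%N] (c * u.1 ^+ (p ^ n)).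

Lemma annihilator_submodule J : Rxf_submodule a p (annihilator J).
Proof.
have hI j := pow_ideal_ideal a (fun=> j); split.
- move=> c _ n /=; rewrite expr0n expn_eq0 eqn0Ngt prime_gt0 // mulr0; exact: (ideal0 (hI _)).
- move=> u v hu hv c Jc n /=; rewrite pfrobD mulrDr !exprMn !mulrA -!exprM mulnDl.
  apply: (idealD (hI _)); first exact/pow_ideal_mulA/hu.
  by rewrite addnC; apply/pow_ideal_mulA/hv.
- by move=> t u hu c Jc n /=; rewrite exprMn mulrCA; apply: (idealMl _ (hI _)); apply: hu.
- by move=> u hu c Jc n /=; rewrite -exprM -mulnA -expnS; apply: hu.
move=> u v hu /H_eqE h c Jc n.
(* Invariance under [H_eq]: compare over a common denominator, then cancel the extra power of
   [A]. *)
have /(pow_ideal_mulA (v.2 * p ^ n)) hcu := hu c Jc n.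
have := idealMl c (hI _) (pow_ideal_frob n h).
rewrite pfrobD pfrobN !exprMn -!exprM mulrBr !mulrA mulnDl => hd.
apply: (pow_ideal_divA areg (n := (u.2 * p ^ n)%N)); rewrite addnC.
by have := idealB (hI _) hcu hd; rewrite subKr.
Qed.

Lemma q_of_in_IH b J : sub_eq J (q_of a p b) -> in_IH a p J.
Proof.
move=> JE; split.
  have hq := q_of_ideal b; split=> [|x y /JE hx /JE hy|r x /JE hx]; apply/JE.
  - exact: ideal0.
  - exact: idealD.
  - exact: idealMl.
exists (annihilator (q_of a p b)); split; first exact: annihilator_submodule.
move=> n r; rewrite JE; split=> [hr u hu|h].
  by apply/H_zero_scale_iter; apply: hu.
(* Testing [r x^n] on the class [x^(k-n) [b / A]] gives the condition at level [k], for every [k]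
   from [n] on. *)
exists n => k nk; apply/q_frobE.
have /h/H_zero_scale_iter /= :
    annihilator (q_of a p b) (b ^+ (p ^ (k - n)), (p ^ (k - n))%N).
  by move=> c /q_ofE hc l; rewrite -exprM -expnD.
by rewrite -exprM -expnD subnK.
Qed.

Lemma q_of_proper b : ~ q_ideal a b -> ~ q_of a p b 1.
Proof.
move=> nb /q_ofE /(_ 0%N); rewrite mul1r expr1 => h.
exact/nb/q_idealE.
Qed.

Lemma in_IH_sub_q_of J :
  (0 < d)%N -> in_IH_proper a p J -> exists b, ~ q_ideal a b /\ subset_of J (q_of a p b).
Proof.
move=> d0 [[hJ [N [hN gN]]] Jp].
have [u [Nu nu]] : exists u, N u /\ ~ 'I_[u.2] u.1.
  (* If all classes in [N] vanished, every [r] would annihilate [N] and [J] would be the whole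
     ring. *)
  apply: NNPP => h; apply: Jp => r; split=> // _; apply/(gN 0%N) => u Nu.
  apply/H_zero_scale_iter; rewrite muln1 expr1.
  apply: (idealMl _ (pow_ideal_ideal _ _)).
  by apply: NNPP => nu; apply: h; exists u.
have [t [b [h nb]]] := nonzero_multiple areg nu.
exists b; split; first by move/q_idealE.
have [_ _ Nscale _ Neq] := hN.
have Nb : N (b, 1%N).
  apply: Neq (Nscale t _ Nu) _; apply/H_eqE => /=.
  (* As [d > 0], the ideal with exponents 0 contains 1, so a nonzero class has a positive
     denominator exponent. *)
  have u2 : (0 < u.2)%N.
    rewrite lt0n; apply/eqP => u0; apply: nu; rewrite u0 -[u.1]mulr1.
    apply: (idealMl _ (pow_ideal_ideal _ _)).
    by have := pow_ideal_gen a (fun=> 0%N) (Ordinal d0); rewrite expr0.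
  have -> : t * u.1 * A ^+ 1 - b * A ^+ u.2 = (t * u.1 - b * A ^+ u.2.-1) * A ^+ 1.
    by rewrite mulrBl -[X in _ = _ - X]mulrA -exprD (addn1 u.2.-1) (prednK u2).
  exact: pow_ideal_mulA.
move=> c Jc; apply/q_ofE => n.
by have /H_zero_scale_iter := (gN n c).1 Jc _ Nb; rewrite mul1n.
Qed.

End FInjective.
End LocalCohomology.

(** * Uniqueness of the dimension and comparison of maximal members *)

Lemma prime_chain_leq (R : comNzRingType) n k :
  (k <= n)%N -> prime_chain R n -> prime_chain R k.
Proof.
move=> kn [P [hP sP]]; exists P; split=> i hi; first by apply/hP/(leq_trans hi).
by apply/sP/(leq_trans hi).
Qed.

Lemma krull_dim_unique (R : comNzRingType) d d' :
  krull_dim_eq R d -> krull_dim_eq R d' -> d = d'.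
Proof.
move=> [c nc] [c' nc']; case: (ltngtP d d') => // [lt|lt].
  by case: nc; apply: prime_chain_leq c'.
by case: nc'; apply: prime_chain_leq c.
Qed.

Theorem theorem5p2 (R : comNzRingType) (m : R -> Prop) (p d : nat)
    (a : 'I_d -> R) :
  prime p -> p \in [pchar R] ->
  local_with_max m -> noetherian R ->
  cohen_macaulay m -> F_injective m p ->
  (0 < d)%N -> sop m a ->
  forall J : R -> Prop,
    maximal_in (in_Z a p) J <-> maximal_in (in_IH_proper a p) J.
Proof.
move=> pp pR _ _ [d' [dim' [x [mx [_ xreg]]]]] Fm d0 [dim ma mrad].
(* The regular sequence must have as many terms as there are parameters. *)
have ed : d' = d by apply: krull_dim_unique dim' dim.
subst d'.
have areg : powers_regular a.
  by apply: (regular_powers_regular xreg) => i; apply: mrad.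
have Finj j r := F_injective_top (j := j) (r := r) areg (prime_gt0 pp) Fm ma mrad.
have ZI J : in_Z a p J -> in_IH_proper a p J.
  move=> [b [nb JE]]; split; first exact: q_of_in_IH JE.
  by move=> JT; apply: (q_of_proper pp pR Finj nb); apply/JE/JT.
have IZ J : in_IH_proper a p J -> exists J', in_Z a p J' /\ subset_of J J'.
  move=> /(in_IH_sub_q_of areg pp pR Finj d0) [b [nb Jb]].
  by exists (q_of a p b); split=> //; exists b.
move=> J; split=> [[JZ Jmax]|[JI Jmax]]; split.
- exact: ZI.
- move=> J' /IZ [K [KZ J'K]] JJ' z /J'K Kz; apply: Jmax KZ _ _ Kz => y /JJ'.
  exact: J'K.
(* The member [K] of Z above [J] is itself a proper member of I(H), so maximality gives [J = K]. *)
- have [K [[b [nb KE]] JK]] := IZ _ JI; exists b; split=> // z; rewrite -KE.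
  split; first exact: JK.
  by apply: Jmax JK _; apply: ZI; exists b.
- by move=> K /ZI; apply: Jmax.
Qed.
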